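(* Suppose $g=0$, and let $\hat{\mathbf p}\in[0,1]^N$ be a stopping strategy. Then $\tau_{\hat{\mathbf p}}$ is an equilibrium stopping time (i.e. $\hat{\mathbf p}$ is an equilibrium) if and only if $\tau_{\hat{\mathbf p}}$ is an optimal stopping time for the problem of maximizing $J_\tau(x)=\mathbb E_x(f(X_\tau))+g(\mathbb E_x(h(X_\tau)))$ (which for $g=0$ equals $\mathbb E_x(f(X_\tau))$) over stopping times $\tau$, i.e. if and only if $J_{\tau_{\hat{\mathbf p}}}(x)=\sup_\tau J_\tau(x)$ for every $x\in E$.
   Context: Setting: $E$ is a finite set with $N$ elements and $X=(X_n)_{n\in\mathbb N_0}$ is a time-homogeneous Markov chain on $E$; under $\mathbb P_x$ (expectation $\mathbb E_x$) one has $X_0=x$ a.s. The chain is absorbing: from every $x\in E$ some absorbing state is reached with positive probability in finitely many steps. $(Y_n)_{n\in\mathbb N_0}$ are i.i.d. uniform on $[0,1]$ and independent of $X$. $f,h:E\to\mathbb R$ are functions and $g:\mathbb R\to\mathbb R$. Vectors in $\mathbb R^N$ are identified with functions on $E$: $\mathbf p=(p_x)_{x\in E}$. Stopping times take values in $\mathbb N_0\cup\{\infty\}$ and are with respect to the filtration $\sigma(X_0,\dots,X_n,Y_0,\dots,Y_n)$, $n\in\mathbb N_0$. Convention: on $\{\tau=\infty\}$, $f(X_\tau):=\lim_{n\to\infty}f(X_n)$ and $h(X_\tau):=\lim_{n\to\infty}h(X_n)$ (the limits exist a.s. because $X$ is absorbing). A (mixed) stopping strategy is a vector $\mathbf p\in[0,1]^N$;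 its stopping time is $\tau_{\mathbf p}=\min\{n\ge0: Y_n\le p_{X_n}\}$ ($=\infty$ if there is no such $n$). Notation: $\phi_{\mathbf p}(x)=\mathbb E_x(f(X_{\tau_{\mathbf p}}))$, $\psi_{\mathbf p}(x)=\mathbb E_x(h(X_{\tau_{\mathbf p}}))$, $J_{\mathbf p}(x)=J_{\tau_{\mathbf p}}(x)=\phi_{\mathbf p}(x)+g(\psi_{\mathbf p}(x))$. A stopping strategy $\hat{\mathbf p}$ is an equilibrium if for all $q\in[0,1]$ and all $x\in E$, $$J_{\hat{\mathbf p}}(x)\ge q f(x)+(1-q)\mathbb E_x(\phi_{\hat{\mathbf p}}(X_1))+g\big(q h(x)+(1-q)\mathbb E_x(\psi_{\hat{\mathbf p}}(X_1))\big);$$ in that case $\tau_{\hat{\mathbf p}}$ is called an equilibrium stopping time. *)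

(* Defs.v *)
From HB Require Import structures.
From mathcomp Require Import all_boot all_order all_algebra.
From mathcomp Require Import all_classical all_reals all_analysis.

Set Implicit Arguments.
Unset Strict Implicit.
Unset Printing Implicit Defensive.

Import Order.TTheory GRing.Theory Num.Theory.
Import numFieldNormedType.Exports.

Local Open Scope classical_set_scope.
Local Open Scope ring_scope.

(* The finite state space [E] carries the discrete sigma-algebra.  The chain is
   [X], and [P x] is the law started from [x]; the [Y n] are the auxiliary
   uniform variables. *)
Section Model.
Context (R : realType) (d : measure_display) (Omega : measurableType d)
        (E : finType).
Implicit Types (P : E -> probability Omega R) (X : nat -> Omega -> E)
  (Y : nat -> {mfun Omega >-> R}).

Definition cylinder X (n : nat) (e : nat -> E) : set Omega :=
  [set w | forall k, (k <= n)%N -> X k w = e k].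

Definition transition P X (y z : E) : \bar R := P y [set w | X 1%N w = z].

(* The Markov property is written in product form, so that nothing is asked of
   conditional probabilities given null events. *)
Definition markov_chain P X : Prop :=
  [/\ forall n e, measurable [set w | X n w = e],
      forall x, P x [set w | X 0%N w = x] = 1%E
    & forall x n (e : nat -> E),
        P x (cylinder X n.+1 e) =
        (P x (cylinder X n e) * transition P X (e n) (e n.+1))%E].

Definition absorbing_state P X (a : E) : Prop := transition P X a a = 1%E.

Definition absorbing_chain P X : Prop :=
  forall x, exists a n,
    absorbing_state P X a /\ (0 < P x [set w | X n w = a])%E.

Definition iid_uniform P Y : Prop := forall x,
  (forall n (B : set R), measurable B ->
     distribution (P x) (Y n) B = uniform_prob (@ltr01 R) B) /\
  (forall (J : seq nat) (B : nat -> set R), uniq J ->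
     (forall k, measurable (B k)) ->
     P x (\bigcap_(k in [set` J]) (Y k @^-1` B k)) =
     (\prod_(k <- J) P x (Y k @^-1` B k))%E).

Definition sigma_X X (n : nat) : set_system Omega :=
  preimage_set_system setT (X n) setT.

Definition sigma_Y Y (n : nat) : set_system Omega :=
  preimage_set_system setT (Y n) measurable.

Definition independent_processes P X Y : Prop :=
  forall x (A B : set Omega),
    <<s \bigcup_n sigma_X X n >> A -> <<s \bigcup_n sigma_Y Y n >> B ->
    P x (A `&` B) = (P x A * P x B)%E.

Definition filtration X Y (n : nat) : set_system Omega :=
  <<s \bigcup_(k in [set k | (k <= n)%N]) (sigma_X X k `|` sigma_Y Y k) >>.

(* A random time has values in [option nat], where [None] stands for infinity. *)
Implicit Types (tau : Omega -> option nat).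

Definition stopping_time X Y tau : Prop :=
  forall n, filtration X Y n [set w | exists2 k, (k <= n)%N & tau w = Some k].

(* [lim] is total; it is the genuine limit for almost every [w] because the
   chain is absorbing. *)
Definition stopped_value X (u : E -> R) tau (w : Omega) : R :=
  match tau w with
  | Some n => u (X n w)
  | None => lim (u (X n w) @[n --> \oo])
  end.

Definition stopped_mean P X (u : E -> R) tau (x : E) : R :=
  fine ('E_(P x) [stopped_value X u tau])%E.

Definition reward P X (f h : E -> R) (g : R -> R) tau (x : E) : R :=
  stopped_mean P X f tau x + g (stopped_mean P X h tau x).

Definition stopping_strategy (p : E -> R) : Prop := forall x, 0 <= p x <= 1.

Definition strategy_time X Y (p : E -> R) (w : Omega) : option nat :=
  match pselect (exists n, Y n w <= p (X n w)) with
  | left ex => Some (ex_minn ex)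
  | right _ => None
  end.

Definition one_step_mean P X (u : E -> R) (x : E) : R :=
  fine ('E_(P x) [fun w => u (X 1%N w)])%E.

Definition equilibrium P X Y (f h : E -> R) (g : R -> R) (p : E -> R) : Prop :=
  let tau := strategy_time X Y p in
  let phi := stopped_mean P X f tau in
  let psi := stopped_mean P X h tau in
  forall (q : R) (x : E), 0 <= q <= 1 ->
    q * f x + (1 - q) * one_step_mean P X phi x +
      g (q * h x + (1 - q) * one_step_mean P X psi x)
    <= reward P X f h g tau x.

(* The supremum is taken in the extended reals, since for a general [g] the
   rewards need not be bounded above. *)
Definition optimal_stopping_time P X Y (f h : E -> R) (g : R -> R) tau : Prop :=
  stopping_time X Y tau /\
  forall x, (reward P X f h g tau x)%:E =
    ereal_sup [set (reward P X f h g sigma x)%:E | sigma in stopping_time X Y].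

End Model.

(* Main.v *)
(* Write T for the one-step mean of the chain and phi for the mean of f stopped
   at the strategy time.  With g = 0, the choices q = 0 and q = 1 turn the
   equilibrium condition into T phi <= phi and f <= phi, and conversely every q
   is a convex combination of these two.  If both hold, phi(X) is a
   supermartingale for the filtration of X and Y, so optional stopping bounds
   every stopped mean of f by phi; absorption allows passing from bounded to
   arbitrary stopping times.  Conversely, the finite-horizon values
   u_0 = f, u_(n+1) = max(f, T u_n) are attained by stopping times, hence lie
   below an optimal phi, while their limit is a superharmonic majorant of f and
   so lies above phi.  Thus phi is that limit, and is superharmonic. *)

Require Import Defs.
From mathcomp Require Import all_boot all_order all_algebra.
From mathcomp Require Import all_classical all_reals all_analysis.
From mathcomp Require Import measurable_realfun.

Set Implicit Arguments.
Unset Strict Implicit.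
Unset Printing Implicit Defensive.

Import Order.TTheory GRing.Theory Num.Theory.
Import numFieldNormedType.Exports.

Local Open Scope classical_set_scope.
Local Open Scope ring_scope.

(** * Expectations of bounded and of finite-valued random variables *)

Section BoundedRandomVariables.
Context (R : realType) (d : measure_display) (Omega : measurableType d).
Implicit Types (Q : probability Omega R) (Z : Omega -> R) (A : set Omega).

(** Closed under the algebraic operations below and integrable for every probability, so this single
    predicate discharges the integrability side conditions under all the laws [P x] at once. *)
Definition bounded_rv Z : Prop :=
  measurable_fun setT Z /\ exists M, forall w, `|Z w| <= M.

Lemma bounded_rv_integrable Q Z :
  bounded_rv Z -> Q.-integrable setT (EFin \o Z).
Proof.
move=> [mZ [M ZM]]; apply: measurable_bounded_integrable => //.
  exact: le_lt_trans (probability_le1 Q measurableT) (ltry _).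
exists M; split; first exact: num_real.
by move=> x /ltW Mx w _; exact: le_trans (ZM w) Mx.
Qed.

Lemma bounded_rv_cst (c : R) : bounded_rv (fun=> c).
Proof. by split => [|]; [exact: measurable_cst|exists `|c|]. Qed.

Lemma bounded_rv_indic A : measurable A -> bounded_rv \1_A.
Proof.
move=> mA; split; first exact: measurable_indic.
by exists 1 => w; rewrite indicE; case: (_ \in _); rewrite ?normr1 ?normr0.
Qed.

Lemma bounded_rvD Z1 Z2 :
  bounded_rv Z1 -> bounded_rv Z2 -> bounded_rv (fun w => Z1 w + Z2 w).
Proof.
move=> [m1 [M1 b1]] [m2 [M2 b2]]; split; first exact: measurable_funD.
by exists (M1 + M2) => w; apply: le_trans (ler_normD _ _) _; exact: lerD.
Qed.

Lemma bounded_rvM Z1 Z2 :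
  bounded_rv Z1 -> bounded_rv Z2 -> bounded_rv (fun w => Z1 w * Z2 w).
Proof.
move=> [m1 [M1 b1]] [m2 [M2 b2]]; split; first exact: measurable_funM.
by exists (M1 * M2) => w; rewrite normrM; apply: ler_pM.
Qed.

Lemma bounded_rvB Z1 Z2 :
  bounded_rv Z1 -> bounded_rv Z2 -> bounded_rv (fun w => Z1 w - Z2 w).
Proof.
move=> [m1 [M1 b1]] [m2 [M2 b2]]; split; first exact: measurable_funB.
by exists (M1 + M2) => w; apply: le_trans (ler_normB _ _) _; exact: lerD.
Qed.

Lemma bounded_rv_sum (I : Type) (s : seq I) (Z : I -> Omega -> R) :
  (forall i, bounded_rv (Z i)) -> bounded_rv (fun w => \sum_(i <- s) Z i w).
Proof.
move=> bZ; elim: s => [|i s IH].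
  by under eq_fun do rewrite big_nil; exact: bounded_rv_cst.
by under eq_fun do rewrite big_cons; exact: bounded_rvD.
Qed.

Lemma Rintegral_sum Q (I : Type) (s : seq I) (Z : I -> Omega -> R) :
  (forall i, bounded_rv (Z i)) ->
  \int[Q]_w (\sum_(i <- s) Z i w) = \sum_(i <- s) \int[Q]_w Z i w.
Proof.
move=> bZ; elim: s => [|i s IH].
  rewrite big_nil; under eq_Rintegral do rewrite big_nil.
  by rewrite Rintegral_cst// mul0r.
rewrite big_cons -IH; under eq_Rintegral do rewrite big_cons.
by rewrite RintegralD//; apply: bounded_rv_integrable => //;
  exact: bounded_rv_sum.
Qed.

Lemma Rintegral_indic Q A : measurable A -> \int[Q]_w \1_A w = fine (Q A).
Proof. by move=> mA; rewrite /Rintegral integral_indic// setIT. Qed.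

Lemma le_Rintegral_bounded_rv Q Z1 Z2 : bounded_rv Z1 -> bounded_rv Z2 ->
  (forall w, Z1 w <= Z2 w) -> \int[Q]_w Z1 w <= \int[Q]_w Z2 w.
Proof.
by move=> b1 b2 le12; apply: le_Rintegral => //; exact: bounded_rv_integrable.
Qed.

Section FiniteValued.
Context (T : finType) (V : Omega -> T).
Hypothesis mV : forall t, measurable [set w | V w = t].

Lemma sum_indic_fiber (u : T -> R) w :
  \sum_t u t * \1_[set w | V w = t] w = u (V w).
Proof.
rewrite (bigD1 (V w))//= big1 ?addr0 => [|t tV].
  by rewrite indicE mem_set// mulr1.
by rewrite indicE memNset ?mulr0// => /esym/eqP; rewrite (negPf tV).
Qed.

Lemma bounded_rv_comp (u : T -> R) : bounded_rv (fun w => u (V w)).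
Proof.
under eq_fun do rewrite -sum_indic_fiber.
apply: bounded_rv_sum => t; apply: bounded_rvM; first exact: bounded_rv_cst.
exact: bounded_rv_indic.
Qed.

Lemma measurable_comp_fiber (S : set T) : measurable [set w | S (V w)].
Proof.
rewrite (_ : [set w | _] = \bigcup_(t in S) [set w | V w = t]).
  by apply: fin_bigcup_measurable.
by apply/seteqP; split => [w Sw|w [t St /= ->]]; [exists (V w)|].
Qed.

Lemma Rintegral_fiber Q Z : bounded_rv Z ->
  \int[Q]_w Z w = \sum_t \int[Q]_w (\1_[set w | V w = t] w * Z w).
Proof.
move=> bZ; rewrite -Rintegral_sum => [|t]; last first.
  by apply: bounded_rvM => //; exact: bounded_rv_indic.
apply: eq_Rintegral => w _; rewrite -mulr_suml.
by rewrite -[X in X * _](_ : 1 = _) ?mul1r// -(sum_indic_fiber (fun=> 1) w);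
  apply: eq_bigr => t _; rewrite mul1r.
Qed.

Lemma Rintegral_indic_comp Q A (u : T -> R) : measurable A ->
  \int[Q]_w (\1_A w * u (V w)) =
  \sum_t u t * fine (Q (A `&` [set w | V w = t])).
Proof.
move=> mA; rewrite Rintegral_fiber; last first.
  by apply: bounded_rvM; [exact: bounded_rv_indic|exact: bounded_rv_comp].
apply: eq_bigr => t _; have mAt := measurableI _ _ mA (mV t).
rewrite -Rintegral_indic// -RintegralZl//; last first.
  by apply: bounded_rv_integrable; exact: bounded_rv_indic.
apply: eq_Rintegral => w _; rewrite indicI/= !indicE.
have [/set_mem/= ->|_] := boolP (w \in [set w | V w = t]).
  by rewrite mul1r mulr1 mulrC.
by rewrite mul0r !mulr0.
Qed.

(** Serves both the initial law of the chain and the step out of an absorbing state. *)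
Lemma Rintegral_point_mass Q (t : T) (u : T -> R) :
  Q [set w | V w = t] = 1%E -> \int[Q]_w u (V w) = u t.
Proof.
move=> Qt.
transitivity (\int[Q]_w (\1_setT w * u (V w))).
  by apply: eq_Rintegral => w _; rewrite indicT mul1r.
rewrite Rintegral_indic_comp// (bigD1 t)//= setTI Qt mulr1 big1 ?addr0//.
move=> s st; rewrite setTI (_ : Q _ = 0%E) ?mulr0//.
apply/eqP; rewrite eq_le measure_ge0 andbT.
have -> : 0%E = Q (~` [set w | V w = t]).
  by rewrite probability_setC// Qt subee.
rewrite le_measure ?inE//; first exact: measurableC.
by move=> w /= -> /eqP; rewrite (negPf st).
Qed.

End FiniteValued.

End BoundedRandomVariables.

(** * Closure properties of generated sigma-algebras *)

Section GeneratedSigmaAlgebras.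
Context (T : Type).
Implicit Types (G : set_system T) (A B : set T).

Lemma g_sigma_algebraI G A B : <<s G >> A -> <<s G >> B -> <<s G >> (A `&` B).
Proof.
move=> GA GB; rewrite -(setCK A) -(setCK B) -setCU -setTD.
apply: sigma_algebraCD; rewrite -bigcup2E.
apply: sigma_algebra_bigcup => -[|[|i]] /=; last exact: sigma_algebra0.
  by rewrite -setTD; exact: sigma_algebraCD.
by rewrite -setTD; exact: sigma_algebraCD.
Qed.

Lemma g_sigma_algebraT G : <<s G >> setT.
Proof.
by have := sigma_algebraCD (@sigma_algebra0 _ setT G); rewrite setD0.
Qed.

End GeneratedSigmaAlgebras.

(** * The Markov property with respect to the joint filtration of [X] and [Y] *)

Section Chain.
Context (R : realType) (d : measure_display) (Omega : measurableType d)
  (E : finType) (P : E -> probability Omega R) (X : nat -> Omega -> E)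
  (Y : nat -> {mfun Omega >-> R}).
Hypothesis markovX : markov_chain P X.

Lemma measurable_fiber n e : measurable [set w | X n w = e].
Proof. by case: markovX. Qed.

Lemma bounded_rv_chain n (u : E -> R) : bounded_rv (fun w => u (X n w)).
Proof. by apply: bounded_rv_comp => t; exact: measurable_fiber. Qed.

Lemma measurable_cylinder n e : measurable (cylinder X n e).
Proof.
rewrite (_ : cylinder X n e =
    \bigcap_(k in [set k | (k <= n)%N]) [set w | X k w = e k]) //.
by apply: bigcap_measurableType => k _; exact: measurable_fiber.
Qed.

Lemma cylinderS n e :
  cylinder X n.+1 e = cylinder X n e `&` [set w | X n.+1 w = e n.+1].
Proof.
apply/seteqP; split => [w cw|w [cw Xw] k].
  by split=> [k kn|]; apply: cw => //; exact: leqW.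
by rewrite leq_eqVlt => /predU1P[->//|]; exact: cw.
Qed.

Lemma sigma_X_cylinder n e : <<s \bigcup_n sigma_X X n >> (cylinder X n e).
Proof.
have fib k : <<s \bigcup_n sigma_X X n >> [set w | X k w = e k].
  apply: sub_sigma_algebra; exists k => //; exists [set e k] => //.
  by rewrite setTI.
elim: n => [|n IH]; last by rewrite cylinderS; exact: g_sigma_algebraI.
rewrite (_ : cylinder _ _ _ = [set w | X 0%N w = e 0%N]) //.
apply/seteqP; split => w /= cw; first exact: cw.
by move=> k; rewrite leqn0 => /eqP ->.
Qed.

Lemma filtration_measurable n A : filtration X Y n A -> measurable A.
Proof.
apply: smallest_sub; first exact: sigma_algebra_measurable.
move=> B [k _ [|]] [S mS <-]; rewrite setTI.
  by apply: (measurable_comp_fiber (measurable_fiber k)).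
by rewrite -[X in measurable X]setTI; exact: measurable_funP.
Qed.

Lemma filtration_fiber n k e : (k <= n)%N ->
  filtration X Y n [set w | X k w = e].
Proof.
move=> kn; apply: sub_sigma_algebra; exists k => //; left.
by exists [set e] => //; rewrite setTI.
Qed.

Lemma filtration_mono m n A : (m <= n)%N ->
  filtration X Y m A -> filtration X Y n A.
Proof.
move=> mn; apply: sub_sigma_algebra2 => B [k km kB]; exists k => //=.
exact: leq_trans km mn.
Qed.

(* On a given path of the chain, an event of the filtration depends on the
   auxiliary variables only. *)
Lemma filtration_trace n A e : filtration X Y n A ->
  exists2 B, <<s \bigcup_n sigma_Y Y n >> B &
    A `&` cylinder X n e = B `&` cylinder X n e.
Proof.
set sY := <<s \bigcup_n sigma_Y Y n >>; set C := cylinder X n e.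
pose G := [set A | exists2 B, sY B & A `&` C = B `&` C].
have traceP D B : (forall w, C w -> D w <-> B w) -> D `&` C = B `&` C.
  by move=> DB; apply/seteqP; split => w [? Cw]; split => //; apply/DB.
have traceE D B : D `&` C = B `&` C -> forall w, C w -> D w <-> B w.
  by move=> DB w Cw; split=> Dw;
    [have: (B `&` C) w by rewrite -DB|have: (D `&` C) w by rewrite DB]; case.
suff : filtration X Y n `<=` G by exact.
apply: smallest_sub.
  split.
  - by exists set0 => //; exact: sigma_algebra0.
  - move=> D [B sB DB]; exists (setT `\` B).
      exact: sigma_algebraCD.
    by apply: traceP => w Cw; have := traceE _ _ DB w Cw; rewrite /setD/=; tauto.
  - move=> D GD; have /choice[B BP] k : exists B, sY B /\ D k `&` C = B `&` C.
      by have [B ? ?] := GD k; exists B.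
    exists (\bigcup_k B k).
      by apply: sigma_algebra_bigcup => k; case: (BP k).
    apply: traceP => w Cw; split => -[k _ wk]; exists k => //.
      by apply/(traceE _ _ (BP k).2 w Cw).
    by apply/(traceE _ _ (BP k).2 w Cw).
move=> D [k kn [|]] [S mS <-]; rewrite setTI.
  (* On the cylinder [X k] equals [e k], so an event about [X k] contains the whole cylinder or
     misses it. *)
  have [Sk|Sk] := pselect (S (e k)).
    exists setT; first exact: g_sigma_algebraT.
    by apply: traceP => w Cw /=; rewrite /preimage/= Cw//.
  exists set0; first exact: sigma_algebra0.
  by apply: traceP => w Cw /=; rewrite /preimage/= Cw//.
exists (Y k @^-1` S) => //; apply: sub_sigma_algebra; exists k => //.
by exists S => //; rewrite setTI.
Qed.

(** In this finite-sum form the one-step mean is visibly monotone, odd in [u] and continuous under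
    pointwise limits. *)
Lemma one_step_meanE (u : E -> R) y :
  one_step_mean P X u y = \sum_z u z * fine (transition P X y z).
Proof.
rewrite /one_step_mean unlock -/(Rintegral _ _ _).
transitivity (\int[P y]_w (\1_setT w * u (X 1%N w))).
  by apply: eq_Rintegral => w _; rewrite indicT mul1r.
rewrite Rintegral_indic_comp//; last exact: measurable_fiber.
by apply: eq_bigr => z _; rewrite setTI.
Qed.

Lemma le_one_step_mean (u v : E -> R) y : (forall z, u z <= v z) ->
  one_step_mean P X u y <= one_step_mean P X v y.
Proof.
move=> uv; rewrite !one_step_meanE; apply: ler_sum => z _.
by rewrite ler_wpM2r// fine_ge0.
Qed.

Lemma one_step_mean_opp (u : E -> R) y :
  one_step_mean P X (fun z => - u z) y = - one_step_mean P X u y.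
Proof.
by rewrite !one_step_meanE -sumrN; apply: eq_bigr => z _; rewrite mulNr.
Qed.

Lemma one_step_mean_cst (c : R) y : one_step_mean P X (fun=> c) y = c.
Proof.
rewrite /one_step_mean unlock integral_cst//.
by rewrite [X in (_ * X)%E]probability_setT mule1.
Qed.

Lemma initial_mean x (u : E -> R) : \int[P x]_w u (X 0%N w) = u x.
Proof.
have [_ init _] := markovX.
by apply: Rintegral_point_mass; [exact: measurable_fiber|exact: init].
Qed.

Lemma one_step_mean_absorbing (u : E -> R) a : absorbing_state P X a ->
  one_step_mean P X u a = u a.
Proof.
move=> aa; rewrite /one_step_mean unlock -/(Rintegral _ _ _).
by apply: Rintegral_point_mass; [exact: measurable_fiber|exact: aa].
Qed.

Hypothesis indepXY : independent_processes P X Y.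

(** On the cylinder, [A] may be replaced by an event of [Y] alone. Independence then factors its
    probability out of both sides, which leaves the Markov property of [X]. *)
Lemma filtration_markov x n A e : filtration X Y n A ->
  P x (A `&` cylinder X n e `&` [set w | X n.+1 w = e n.+1]) =
  (P x (A `&` cylinder X n e) * transition P X (e n) (e n.+1))%E.
Proof.
have [_ _ markov] := markovX.
move=> /(filtration_trace e)[B sB AB].
rewrite AB -setIA -cylinderS ![B `&` _]setIC.
by rewrite !indepXY ?markov//; [rewrite muleAC|exact: sigma_X_cylinder..].
Qed.

(** Histories up to time [n] are finite functions, so that there are finitely many of them, whereas
    [cylinder] expects an infinite sequence. The constant tail [z] also supplies the state at time
    [n.+1]. *)
Definition path_extension n (e : {ffun 'I_n.+1 -> E}) (z : E) (k : nat) : E :=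
  if (k <= n)%N then e (inord k) else z.

(** Both sides are split over the finitely many histories up to time [n], and [filtration_markov] is
    applied to each of them. *)
Lemma mean_next x n A (u : E -> R) : filtration X Y n A ->
  \int[P x]_w (\1_A w * u (X n.+1 w)) =
  \int[P x]_w (\1_A w * one_step_mean P X u (X n w)).
Proof.
move=> FA; have mA := filtration_measurable FA.
pose V w : {ffun 'I_n.+1 -> E} := [ffun k => X (val k) w].
have VE e z : [set w | V w = e] = cylinder X n (path_extension e z).
  apply/seteqP; split => w /= => [<- k kn|cw].
    by rewrite /path_extension kn ffunE /= inordK.
  apply/ffunP => k; have kn : (k <= n)%N by rewrite -ltnS.
  by rewrite ffunE [LHS](cw _ kn) /path_extension kn inord_val.
have mV e : measurable [set w | V w = e].
  by rewrite (VE e (e ord0)); exact: measurable_cylinder.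
have bA m (v : E -> R) : bounded_rv (fun w => \1_A w * v (X m w)).
  by apply: bounded_rvM; [exact: bounded_rv_indic|exact: bounded_rv_chain].
rewrite (Rintegral_fiber mV)// [RHS](Rintegral_fiber mV)//.
apply: eq_bigr => e _; have mAe := measurableI _ _ mA (mV e).
have indE (v : E -> R) m :
    \int[P x]_w (\1_[set w | V w = e] w * (\1_A w * v (X m w))) =
    \int[P x]_w (\1_(A `&` [set w | V w = e]) w * v (X m w)).
  by apply: eq_Rintegral => w _; rewrite indicI/= mulrA [X in X * _]mulrC.
rewrite (indE u n.+1) (indE (one_step_mean P X u) n).
rewrite Rintegral_indic_comp//; last exact: measurable_fiber.
(* A history [e] fixes [X n] as [e ord_max], so the one-step mean is constant on its fiber. *)
transitivity (\int[P x]_w (one_step_mean P X u (e ord_max) *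
    \1_(A `&` [set w | V w = e]) w)); last first.
  apply: eq_Rintegral => w _; rewrite mulrC indicE.
  have [/set_mem/= [_ <-]|_] := boolP (w \in _); last by rewrite !mul0r.
  by rewrite ffunE.
rewrite RintegralZl//; last by apply/bounded_rv_integrable/bounded_rv_indic.
rewrite Rintegral_indic// one_step_meanE mulr_suml; apply: eq_bigr => z _.
rewrite -mulrA; congr (_ * _); rewrite (VE e z).
have ez : path_extension e z n.+1 = z by rewrite /path_extension ltnn.
have en : path_extension e z n = e ord_max.
  rewrite /path_extension leqnn; congr (e _).
  by apply/val_inj; rewrite /= inordK.
have := filtration_markov x (path_extension e z) FA; rewrite ez en => ->.
rewrite fineM; [by rewrite mulrC|by rewrite fin_num_measure// -VE|].
by rewrite fin_num_measure//; exact: measurable_fiber.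
Qed.

(** * Optional stopping at bounded times *)

Section OptionalStopping.
Implicit Types (tau : Omega -> option nat) (v : nat -> E -> R).

Definition stopped_by tau n : set Omega :=
  [set w | exists2 k, (k <= n)%N & tau w = Some k].

Definition stopped_index tau n w : nat :=
  if tau w is Some k then minn k n else n.

(** The function [v] may depend on time, so that one argument covers a fixed superharmonic function
    as well as values depending on the remaining horizon. *)
Definition stopped_process tau v n w : R :=
  v (stopped_index tau n w) (X (stopped_index tau n w) w).

Lemma stopped_process0 tau v w : stopped_process tau v 0 w = v 0%N (X 0%N w).
Proof.
by rewrite /stopped_process /stopped_index; case: (tau w) => // k; rewrite minn0.
Qed.

(** The increment lives on the event that [tau] exceeds [n], which belongs to the filtration at time
    [n]; this is the form to which [mean_next] applies. *)
Lemma stopped_processS tau v n w :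
  stopped_process tau v n.+1 w = stopped_process tau v n w +
    \1_(~` stopped_by tau n) w * (v n.+1 (X n.+1 w) - v n (X n w)).
Proof.
have stop k : tau w = Some k -> (k <= n)%N -> w \notin ~` stopped_by tau n.
  by move=> tk kn; rewrite notin_setE /=; apply; exists k.
have go : (forall k, tau w = Some k -> (n < k)%N) -> w \in ~` stopped_by tau n.
  by move=> lt; rewrite inE => -[k kn /lt]; rewrite ltnNge kn.
rewrite /stopped_process /stopped_index indicE; case tw: (tau w) => [k|].
  have [kn|nk] := leqP k n.
    rewrite (negPf (stop _ tw kn)) mul0r addr0.
    by rewrite (minn_idPl (leqW kn)).
  rewrite (minn_idPr nk) go ?mul1r ?subrKC//.
  by move=> j; rewrite tw => -[<-].
by rewrite go ?mul1r ?subrKC// => j; rewrite tw.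
Qed.

Lemma stopped_by_filtration tau n : stopping_time X Y tau ->
  filtration X Y n (~` stopped_by tau n).
Proof. by move=> st; rewrite -setTD; apply: sigma_algebraCD; exact: st. Qed.

Lemma bounded_rv_stopped_process tau v n : stopping_time X Y tau ->
  bounded_rv (stopped_process tau v n).
Proof.
move=> st; elim: n => [|n IH].
  by rewrite (funext (stopped_process0 tau v)); exact: bounded_rv_chain.
rewrite (funext (stopped_processS tau v n)).
apply: bounded_rvD => //; apply: bounded_rvM.
  exact: bounded_rv_indic (filtration_measurable (stopped_by_filtration st)).
by apply: bounded_rvB; exact: bounded_rv_chain.
Qed.

(** By [mean_next] each increment has nonpositive mean. The drift inequality is needed only on paths
    not yet stopped, since the increments vanish on the others. *)
Lemma stopped_process_supermartingale x tau v n : stopping_time X Y tau ->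
  (forall k w, ~ stopped_by tau k w ->
     one_step_mean P X (v k.+1) (X k w) <= v k (X k w)) ->
  \int[P x]_w stopped_process tau v n w <= v 0%N x.
Proof.
move=> st sup; elim: n => [|n]; last apply: le_trans.
  under eq_Rintegral do rewrite stopped_process0.
  by rewrite initial_mean.
under eq_Rintegral do rewrite stopped_processS mulrBr.
have Fn : filtration X Y n (~` stopped_by tau n) := stopped_by_filtration st.
have bI := @bounded_rv_indic R _ _ _ (filtration_measurable Fn).
have bX m u : bounded_rv (fun w => \1_(~` stopped_by tau n) w * u (X m w) : R).
  by apply: bounded_rvM => //; exact: bounded_rv_chain.
rewrite RintegralD//; [|apply: bounded_rv_integrable..]; first last.
- by apply: bounded_rvB; exact: bX.
- exact: bounded_rv_stopped_process.
rewrite gerDl RintegralB//; [|by apply: bounded_rv_integrable; exact: bX..].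
rewrite subr_le0 mean_next//; apply: le_Rintegral_bounded_rv; [exact: bX..|].
move=> w; rewrite indicE; have [|_] := boolP (w \in _); last by rewrite !mul0r.
by rewrite inE !mul1r => /sup.
Qed.

Lemma stopped_process_submartingale x tau v n : stopping_time X Y tau ->
  (forall k w, ~ stopped_by tau k w ->
     v k (X k w) <= one_step_mean P X (v k.+1) (X k w)) ->
  v 0%N x <= \int[P x]_w stopped_process tau v n w.
Proof.
move=> st sub; rewrite -lerN2 -mulN1r -RintegralZl//; last first.
  by apply: bounded_rv_integrable; exact: bounded_rv_stopped_process.
under eq_Rintegral do rewrite mulN1r.
apply: (@stopped_process_supermartingale x tau (fun k y => - v k y)) => //.
by move=> k w /sub; rewrite one_step_mean_opp lerN2.
Qed.

(** The event [A k] need only lie between [tau = k] and [tau <= k]: the union of the [A k] over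
    [k <= n] is then [tau <= n]. A stopping criterion can thus be tested at time [k] without saying
    that it failed before. *)
Lemma hitting_stopping_time tau (A : nat -> set Omega) :
  (forall k, filtration X Y k (A k)) ->
  (forall k w, tau w = Some k -> A k w) ->
  (forall k w, A k w -> stopped_by tau k w) ->
  stopping_time X Y tau.
Proof.
move=> FA tauA Atau n.
rewrite (_ : [set w | _] = \bigcup_k (if (k <= n)%N then A k else set0)).
  apply: sigma_algebra_bigcup => k; case: ifPn => kn; last exact: sigma_algebra0.
  exact: filtration_mono kn (FA k).
apply/seteqP; split => w.
  by move=> [k kn /tauA Akw]; exists k => //; rewrite kn.
move=> [k _]; case: ifPn => // kn /Atau[j jk tj]; exists j => //.
exact: leq_trans jk kn.
Qed.

Lemma filtration_chain n (A : E -> set Omega) :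
  (forall e, filtration X Y n (A e)) -> filtration X Y n [set w | A (X n w) w].
Proof.
move=> FA; rewrite (_ : [set w | _] = \bigcup_k
    (if unpickle k is Some e then [set w | X n w = e] `&` A e else set0)).
  apply: sigma_algebra_bigcup => k.
  case: unpickle => [e|]; last exact: sigma_algebra0.
  by apply: g_sigma_algebraI; [exact: filtration_fiber|exact: FA].
apply/seteqP; split => w.
  by move=> AXw; exists (pickle (X n w)) => //; rewrite pickleK.
by move=> [k _]; case: unpickle => // e [/= -> ].
Qed.

Lemma strategy_time_stopping (p : E -> R) :
  stopping_time X Y (strategy_time X Y p).
Proof.
apply: (hitting_stopping_time (A := fun k => [set w | Y k w <= p (X k w)])).
  move=> k; apply: (filtration_chain (A := fun e => [set w | Y k w <= p e])) => e.
  apply: sub_sigma_algebra; exists k => //=; right; exists [set` `]-oo, p e]] => //.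
  by rewrite setTI; apply/seteqP; split => w /=; rewrite in_itv.
  move=> k w; rewrite /strategy_time; case: pselect => // ex [<-].
  by case: ex_minnP.
move=> k w Yk; rewrite /stopped_by /strategy_time /=.
case: pselect => [ex|[]]; last by exists k.
by case: ex_minnP => m _ /(_ _ Yk) mk; exists m.
Qed.

End OptionalStopping.

(** * Almost sure absorption of the chain *)

Section Absorption.
Hypothesis absX : absorbing_chain P X.

Local Notation T := (one_step_mean P X).

Lemma iter_one_step_meanE x n (u : E -> R) :
  \int[P x]_w u (X n w) = iter n T u x.
Proof.
elim: n u => [|n IH] u; first exact: initial_mean.
rewrite iterSr -IH.
transitivity (\int[P x]_w (\1_setT w * u (X n.+1 w))).
  by apply: eq_Rintegral => w _; rewrite indicT mul1r.
rewrite mean_next; last exact: g_sigma_algebraT.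
by apply: eq_Rintegral => w _; rewrite indicT mul1r.
Qed.

Lemma one_step_mean_cvg (u : nat -> E -> R) (v : E -> R) y :
  (forall z, u n z @[n --> \oo] --> v z) ->
  T (u n) y @[n --> \oo] --> T v y.
Proof.
move=> uv; under eq_fun do rewrite one_step_meanE.
rewrite one_step_meanE; apply: cvg_big => [|z _].
  exact: add_continuous.
exact: cvgMl.
Qed.

(** A maximum principle. At a maximiser [y0] invariance gives [r y0 - r (X n)] mean zero. This
    difference is nonnegative, and equals [r y0] when [X n] is an absorbing state [a]; for some [a]
    and [n] that has positive probability, so [r y0 <= 0]. *)
Lemma invariant_eq0 (r : E -> R) :
  (forall y, 0 <= r y) -> T r = r ->
  (forall a, absorbing_state P X a -> r a = 0) -> forall y, r y = 0.
Proof.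
move=> r0 Tr ra y.
pose y0 := [arg max_(z > y) r z]%O.
have ry0 z : r z <= r y0 by rewrite /y0; case: arg_maxP => // i _; apply.
suff le0 : r y0 <= 0.
  by apply/eqP; rewrite eq_le r0 (le_trans (ry0 y) le0).
have [a [n [aa Pa]]] := absX y0.
have iterr : iter n T r = r by elim: n {Pa} => //= n ->.
have ind_rv := bounded_rv_indic R (measurable_fiber n a).
have : \int[P y0]_w (r y0 * \1_[set w | X n w = a] w) <=
    \int[P y0]_w (r y0 - r (X n w)).
  apply: le_Rintegral_bounded_rv => [||w].
  - by apply: bounded_rvM => //; exact: bounded_rv_cst.
  - by apply: bounded_rvB; [exact: bounded_rv_cst|exact: bounded_rv_chain].
  rewrite indicE; have [/set_mem/= ->|_] := boolP (w \in _).
    by rewrite mulr1 (ra a aa) subr0.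
  by rewrite mulr0 subr_ge0 ry0.
rewrite RintegralZl//; last exact: bounded_rv_integrable.
rewrite RintegralB//; first last.
- by apply: bounded_rv_integrable; exact: bounded_rv_chain.
- by apply: bounded_rv_integrable; exact: bounded_rv_cst.
rewrite iter_one_step_meanE iterr Rintegral_cst// Rintegral_indic; last first.
  exact: measurable_fiber.
have -> : fine (P y0 setT) = 1 by rewrite probability_setT.
rewrite mulr1 subrr pmulr_lle0//.
by rewrite fine_gt0// Pa/= (le_lt_trans (probability_le1 _ _))// ?ltry//;
  exact: measurable_fiber.
Qed.

Let absorbed : set Omega := [set w | exists n, absorbing_state P X (X n w)].

Let transient y : R := (~~ `[< absorbing_state P X y >])%:R.

(** The iterate is the probability of not being in an absorbing state at time [n]. It decreases in
    [n], and its limit is invariant and vanishes at absorbing states, so the maximum principle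
    applies. *)
Lemma transient_mean_cvg x : iter n T transient x @[n --> \oo] --> (0 : R).
Proof.
have b0 n y : 0 <= iter n T transient y.
  case: n => [|n]; first by rewrite /= ler0n.
  rewrite iterS -(one_step_mean_cst 0 y).
  apply: le_one_step_mean; elim: n => [|n IH] z; first by rewrite /= ler0n.
  by rewrite iterS -(one_step_mean_cst 0 z); exact: le_one_step_mean.
have bS n y : iter n.+1 T transient y <= iter n T transient y.
  elim: n y => [|n IH] y; last first.
    by rewrite iterS [in leRHS]iterS; exact: le_one_step_mean.
  rewrite /= {2}/transient; case: asboolP => [ya|_].
    by rewrite one_step_mean_absorbing// /transient asboolT.
  rewrite -[leRHS](one_step_mean_cst 1 y); apply: le_one_step_mean => z.
  by rewrite /transient; case: (~~ _).
have bcvg y : cvgn (fun n => iter n T transient y).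
  apply: nonincreasing_is_cvgn; first by apply/nonincreasing_seqP => n; exact: bS.
  by exists 0 => _ [n _ <-]; exact: b0.
pose r y := limn (fun n => iter n T transient y).
suff -> : 0 = r x by exact: bcvg.
apply/esym/invariant_eq0 => [y||a aa].
- by apply: limr_ge => //; apply: nearW => n; exact: b0.
- apply/funext => y.
  have Tr : iter n.+1 T transient y @[n --> \oo] --> T r y.
    by apply: (@one_step_mean_cvg (fun n => iter n T transient)) => z; exact: bcvg.
  apply: (cvg_unique _ Tr) => //.
  by have := bcvg y; rewrite -(cvg_shiftS (fun n => iter n T transient y)).
- apply/cvg_lim => //; apply: cvg_near_cst; apply: nearW => n.
  elim: n => [|n IH]; first by rewrite /= /transient asboolT.
  by rewrite iterS one_step_mean_absorbing.
Qed.

Lemma ae_absorbed x : {ae P x, forall w, absorbed w}.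
Proof.
have mtr n : measurable [set w | ~ absorbing_state P X (X n w)].
  apply: (measurable_comp_fiber (measurable_fiber n)
    [set y | ~ absorbing_state P X y]).
set N := \bigcap_n [set w | ~ absorbing_state P X (X n w)].
have mN : measurable N by exact: bigcapT_measurable.
exists N; split => //; last first.
  by move=> w /= nabs n _ /= ?; apply: nabs; exists n.
(* Never being absorbed implies being transient at each time [n]. *)
have N_le n : fine (P x N) <= iter n T transient x.
  rewrite -iter_one_step_meanE -Rintegral_indic//.
  apply: le_Rintegral_bounded_rv => [||w].
  - exact: bounded_rv_indic.
  - exact: bounded_rv_chain.
  rewrite indicE /transient; have [/set_mem Nw|_] := boolP (w \in N).
    by rewrite asboolF//; exact: Nw.
  by rewrite ler0n.
rewrite -[LHS]fineK ?fin_num_measure//; congr EFin; apply/eqP.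
rewrite eq_le fine_ge0// andbT -(cvg_lim _ (transient_mean_cvg x))//.
by apply: limr_ge; [exact: cvgP (transient_mean_cvg x)|exact: nearW].
Qed.

(** For each time there are finitely many pairs of states, so it suffices that each single jump from
    an absorbing state [a] to some [z] other than [a] is null. *)
Lemma ae_stay_absorbed x : {ae P x, forall w, forall n,
  absorbing_state P X (X n w) -> X n.+1 w = X n w}.
Proof.
apply: ae_foralln => n.
suff : {ae P x, forall w, forall p : E * E, absorbing_state P X p.1 ->
    p.1 != p.2 -> ~ (X n w = p.1 /\ X n.+1 w = p.2)}.
  apply: filterS => w H aX; apply/eqP/negPn/negP => ne.
  by apply: (H (X n w, X n.+1 w)) => //=; rewrite eq_sym.
apply: filter_forall => -[a z] /=.
have [[aa az]|naz] := pselect (absorbing_state P X a /\ a != z); last first.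
  by apply: nearW => w aa az; case: naz.
exists ([set w | X n w = a] `&` [set w | X n.+1 w = z]); split.
- by apply: measurableI; exact: measurable_fiber.
- rewrite -[LHS]fineK ?fin_num_measure//; last first.
    by apply: measurableI; exact: measurable_fiber.
  congr EFin; rewrite -Rintegral_indic; last first.
    by apply: measurableI; exact: measurable_fiber.
  pose u y : R := (y == z)%:R.
  transitivity (\int[P x]_w (\1_[set w | X n w = a] w * u (X n.+1 w))).
    apply: eq_Rintegral => w _; rewrite indicI/= !indicE.
    congr (_ * (nat_of_bool _)%:R).
    by apply/idP/eqP => [/set_mem|?]; last exact/mem_set.
  rewrite mean_next; last exact: filtration_fiber.
  transitivity (\int[P x]_w (0 : R)); last by rewrite Rintegral_cst// mul0r.
  apply: eq_Rintegral => w _; rewrite indicE.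
  have [/set_mem/= ->|_] := boolP (w \in _); last by rewrite mul0r.
  by rewrite one_step_mean_absorbing// /u (negPf az) mulr0.
- by move=> w /= H; apply: contrapT => nX; apply: H => _ _; exact: nX.
Qed.


Lemma ae_eventually_constant x :
  {ae P x, forall w, exists n, forall m, (n <= m)%N -> X m w = X n w}.
Proof.
apply: filterS2 (ae_absorbed x) (ae_stay_absorbed x) => w [n aXn] stay.
exists n => m /subnKC <-; elim: (m - n)%N => [|k IH]; first by rewrite addn0.
by rewrite addnS stay// IH.
Qed.

(** * Measurability of stopped values and passage to unbounded stopping times *)

Lemma limit_range (u : E -> R) (e : nat -> E) :
  cvgn (u \o e) -> exists y, \forall n \near \oo, u (e n) = u y.
Proof.
move=> cvu; set l := limn (u \o e).
have fin_rng : finite_set (range u) by exact: finite_image.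
have cl (A : set R) : finite_set A -> closed A.
  apply: (@accessible_finite_set_closed R).1; apply: hausdorff_accessible.
  exact: Rhausdorff.
have [y _ uy] : range u l.
  apply: (@closed_cvg _ _ _ _ (u \o e) _ (cl _ fin_rng) _ l cvu).
  by apply: nearW => n /=; exists (e n).
exists y; rewrite uy.
(* The range of [u] is finite, so the limit has a neighbourhood free of all its other values; the
   sequence is therefore eventually equal to its limit. *)
have : nbhs l (~` (range u `\ l)).
  apply: open_nbhs_nbhs; split; last by move=> [_ /=].
  exact: closed_openC (cl _ (finite_setD _ fin_rng)).
move=> /cvu[N _ Nr]; exists N => // n /Nr /= nr; apply: contrapT => ne; apply: nr.
by split=> //; exists (e n).
Qed.

Let tail_value (c : R) (u : E -> R) : set Omega :=
  \bigcup_n \bigcap_(m in [set m | (n <= m)%N]) [set w | u (X m w) = c].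

Lemma measurable_tail_value c u : measurable (tail_value c u).
Proof.
apply: bigcupT_measurable => n; apply: bigcap_measurableType => m _.
exact: (measurable_comp_fiber (measurable_fiber m) [set y | u y = c]).
Qed.

Lemma tail_value_lim c u w : tail_value c u w -> limn (fun n => u (X n w)) = c.
Proof.
move=> [n _ uX]; apply/cvg_lim => //; apply: cvg_near_cst.
by exists n => // m nm; exact: uX.
Qed.

(** Makes the total [lim] measurable on every path. A path with no tail value diverges under [u], by
    [limit_range], and then [lim] returns [point]; hence the shift by [point]. With [undup] each
    value is counted once. *)
Lemma limit_value_indic (u : E -> R) w :
  limn (fun n => u (X n w)) = point +
    \sum_(c <- undup (codom u)) (c - point) * \1_(tail_value c u) w.
Proof.
have in_codom c : tail_value c u w -> c \in undup (codom u).
  by move=> [n _ /(_ n (leqnn n))/= <-]; rewrite mem_undup codom_f.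
have [[c tc]|nt] := pselect (exists c, tail_value c u w).
  rewrite (tail_value_lim tc) (bigD1_seq c) ?undup_uniq ?in_codom//=.
  rewrite indicE mem_set// mulr1 big1 ?addr0 ?subrKC// => c' c'c.
  rewrite indicE memNset ?mulr0// => tc'.
  by rewrite -(tail_value_lim tc) (tail_value_lim tc') eqxx in c'c.
rewrite big1 ?addr0 => [|c _]; last first.
  by rewrite indicE memNset ?mulr0// => tc; apply: nt; exists c.
apply: dvgP => /(@limit_range u (X^~ w))[y [n _ uy]].
by apply: nt; exists (u y), n.
Qed.

Lemma measurable_stopped_value (u : E -> R) tau : stopping_time X Y tau ->
  measurable_fun setT (stopped_value X u tau).
Proof.
move=> st; pose L w := limn (fun n => u (X n w)).
have mL : bounded_rv L.
  rewrite /L (funext (limit_value_indic u)).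
  apply: bounded_rvD; first exact: bounded_rv_cst.
  apply: bounded_rv_sum => c; apply: bounded_rvM; first exact: bounded_rv_cst.
  exact/bounded_rv_indic/measurable_tail_value.
(* On paths stopped by time [n] this is already the stopped value, and on the others it is the limit
   [L]; for each path it is eventually constant in [n]. *)
pose W n w := stopped_process tau (fun=> u) n w +
  \1_(~` stopped_by tau n) w * (L w - stopped_process tau (fun=> u) n w).
apply: (@measurable_fun_cvg _ _ _ _ W) => [n|w _].
  have bS := bounded_rv_stopped_process (fun=> u) n st.
  have Fn : filtration X Y n (~` stopped_by tau n) := stopped_by_filtration st.
  have bI := @bounded_rv_indic R _ _ _ (filtration_measurable Fn).
  suff [] : bounded_rv (W n) by [].
  by apply: bounded_rvD => //; apply: bounded_rvM => //; exact: bounded_rvB.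
apply: cvg_near_cst; rewrite /W /stopped_value /stopped_process /stopped_index.
case tw: (tau w) => [k|].
  exists k => // n /= kn; rewrite (minn_idPl kn) indicE memNset ?mul0r ?addr0//.
  by apply; exists k.
apply: nearW => n; rewrite indicE mem_set ?mul1r ?subrKC//.
by move=> [k _]; rewrite tw.
Qed.

(** Dominated convergence: when [tau] is infinite, almost every path is eventually constant, so the
    stopped process reaches its limit after finitely many steps. *)
Lemma stopped_mean_cvg (u : E -> R) tau x : stopping_time X Y tau ->
  \int[P x]_w stopped_process tau (fun=> u) n w @[n --> \oo] -->
  stopped_mean P X u tau x.
Proof.
move=> st; pose M := \sum_y `|u y|.
have uM y : `|u y| <= M by rewrite /M (bigD1 y)//= lerDl sumr_ge0.
have iM : (P x).-integrable setT (EFin \o cst M).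
  by apply: bounded_rv_integrable; exact: bounded_rv_cst.
have mS := measurable_stopped_value u st.
have bS n := bounded_rv_stopped_process (fun=> u) n st.
have [] := @dominated_convergence _ _ _ (P x) _ measurableT
  (fun n w => (stopped_process tau (fun=> u) n w)%:E)
  (fun w => (stopped_value X u tau w)%:E) _ _ _ _ iM _.
- by move=> n; apply/measurable_EFinP; have [] := bS n.
- exact/measurable_EFinP.
- apply: filterS (ae_eventually_constant x) => w [n0 Xw] _.
  apply/fine_cvgP => /=; split; first exact: nearW.
  rewrite /stopped_value /stopped_process /stopped_index/=.
  case: (tau w) => [k|].
    apply: cvg_near_cst; exists k => // n /= kn /=.
    by rewrite /= (minn_idPl kn).
  have XE : \forall n \near \oo, u (X n w) = u (X n0 w).
    by exists n0 => // n /= n0n; rewrite Xw.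
  rewrite (_ : limn _ = u (X n0 w)); first exact: cvg_near_cst.
  by apply/cvg_lim => //; exact: cvg_near_cst.
- by apply: nearW => w n _; rewrite /= lee_fin; exact: uM.
- move=> iS _ cvgS.
rewrite /stopped_mean unlock; apply: fine_cvg; rewrite fineK//.
exact: integrable_fin_num.
Qed.

(** At each bounded time the mean of [u] is at most that of [v], hence at most [v x] by the
    supermartingale bound; then the horizon tends to infinity. *)
Lemma le_stopped_mean (u v : E -> R) tau x : stopping_time X Y tau ->
  (forall y, u y <= v y) -> (forall y, T v y <= v y) ->
  stopped_mean P X u tau x <= v x.
Proof.
move=> st uv Tv; have cvgS := @stopped_mean_cvg u tau x st.
rewrite -(cvg_lim _ cvgS)//; apply: limr_le; first exact: cvgP cvgS.
apply: nearW => n.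
apply: le_trans (@stopped_process_supermartingale x tau (fun=> v) n st _).
  by apply: le_Rintegral_bounded_rv => [||w];
    [exact: bounded_rv_stopped_process..|exact: uv].
by move=> k w _; exact: Tv.
Qed.

(** * Finite-horizon values and dynamic programming *)

Section Bellman.
Context (f : E -> R).

Fixpoint bellman n : E -> R :=
  if n is m.+1 then fun y => Num.max (f y) (T (bellman m) y) else f.

Lemma le_bellman n y : f y <= bellman n y.
Proof. by case: n => [|n] //=; rewrite le_max lexx. Qed.

Lemma bellmanS n y : bellman n y <= bellman n.+1 y.
Proof.
elim: n y => [|n IH] y; first exact: le_bellman 1%N y.
rewrite [leLHS]/= [leRHS]/= ge_max !le_max lexx/=.
by apply/orP; right; exact: le_one_step_mean.
Qed.

(** At time [n] no step remains and the value is [f] itself, so the rule of stopping once [f]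
    attains the remaining value stops by time [n]. *)
Lemma bellman_stops n w : exists k, bellman (n - k) (X k w) <= f (X k w).
Proof. by exists n; rewrite subnn. Qed.

Definition bellman_time n w : option nat := Some (ex_minn (bellman_stops n w)).

Lemma bellman_time_stopping n : stopping_time X Y (bellman_time n).
Proof.
apply: (hitting_stopping_time
    (A := fun k => [set w | bellman (n - k) (X k w) <= f (X k w)])).
- move=> k; apply: (filtration_chain
    (A := fun e => [set w | bellman (n - k) e <= f e])) => e.
  (* For a fixed state the test does not involve [w], so the event is everything or empty. *)
  have [ef|ef] := boolP (bellman (n - k) e <= f e).
    rewrite (_ : [set w | _] = setT); first exact: g_sigma_algebraT.
    by apply/seteqP; split.
  rewrite (_ : [set w | _] = set0); first exact: sigma_algebra0.
  by apply/seteqP; split.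
- by move=> k w [<-]; case: ex_minnP.
- by move=> k w Ak; eexists; last reflexivity; case: ex_minnP => m _; exact.
Qed.

(** Before the rule stops, [f] lies strictly below the value, so the maximum is the one-step mean
    and the values of the remaining horizon form a submartingale; on stopping they are at most
    [f]. *)
Lemma le_bellman_stopped_mean n x :
  bellman n x <= stopped_mean P X f (bellman_time n) x.
Proof.
have st := bellman_time_stopping n.
have time_le w : (ex_minn (bellman_stops n w) <= n)%N.
  by case: ex_minnP => m _; apply; rewrite subnn.
have -> : stopped_mean P X f (bellman_time n) x =
    \int[P x]_w stopped_process (bellman_time n) (fun=> f) n w.
  rewrite /stopped_mean unlock; apply: eq_Rintegral => w _.
  rewrite /stopped_value /stopped_process /stopped_index /=.
  by rewrite (minn_idPl (time_le w)).
rewrite -{1}(subn0 n).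
apply: le_trans
  (@stopped_process_submartingale x _ (fun k => bellman (n - k)) n st _) _.
  move=> k w nst; have : (k < ex_minn (bellman_stops n w))%N.
    by rewrite ltnNge; apply/negP => mk; apply: nst; eexists; [exact: mk|].
  move: (time_le w); case: ex_minnP => m _ m_min mn km.
  have : ~~ (bellman (n - k) (X k w) <= f (X k w)).
    by apply/negP => /m_min; rewrite leqNgt km.
  (* Since [k < n], the remaining horizon [n - k] is a successor and [bellman] unfolds to its
     maximum. *)
  rewrite -(subnSK (leq_trans km mn)) /= ge_max lexx/= -ltNge => lt_fT.
  by rewrite ge_max lexx (ltW lt_fT).
apply: le_Rintegral_bounded_rv => [||w]; [exact: bounded_rv_stopped_process..|].
rewrite /stopped_process /stopped_index /= (minn_idPl (time_le w)).
by case: ex_minnP.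
Qed.

(** Superharmonicity of the optimal mean is not checked directly: it is inherited from the limit [u]
    of the finite-horizon values. *)
Lemma value_superharmonic tau : stopping_time X Y tau ->
  (forall sigma x, stopping_time X Y sigma ->
     stopped_mean P X f sigma x <= stopped_mean P X f tau x) ->
  forall y, f y <= stopped_mean P X f tau y /\
    T (stopped_mean P X f tau) y <= stopped_mean P X f tau y.
Proof.
move=> st opt; set phi := stopped_mean P X f tau.
have bphi n y : bellman n y <= phi y.
  exact: le_trans (le_bellman_stopped_mean n y) (opt _ _ (bellman_time_stopping n)).
have bcvg y : cvgn (fun n => bellman n y).
  apply: nondecreasing_is_cvgn; first by apply/nondecreasing_seqP => n; exact: bellmanS.
  by exists (phi y) => _ [n _ <-].
pose u y := limn (fun n => bellman n y).
have bu n y : bellman n y <= u y.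
  apply: (nondecreasing_cvgn_le _ (bcvg y)).
  by apply/nondecreasing_seqP => k; exact: bellmanS.
(* Limit of [T (bellman n) y <= bellman n.+1 y <= u y]. *)
have Tu y : T u y <= u y.
  have Tcvg : T (bellman n) y @[n --> \oo] --> T u y.
    by apply: one_step_mean_cvg => z; exact: bcvg.
  rewrite -(cvg_lim _ Tcvg)//; apply: limr_le; first exact: cvgP Tcvg.
  apply: nearW => n; apply: le_trans (bu n.+1 y).
  by rewrite /= le_max lexx orbT.
have -> : phi = u.
  apply/funext => y; apply/eqP; rewrite eq_le; apply/andP; split.
    by apply: le_stopped_mean => // z; exact: bu 0%N z.
  by apply: limr_le; [exact: bcvg|exact: nearW].
by move=> y; split => //; exact: bu 0%N y.
Qed.

End Bellman.

End Absorption.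
End Chain.

(** * Equilibria and optimal stopping times *)

Theorem theorem2p11 (R : realType) (d : measure_display)
    (Omega : measurableType d) (E : finType)
    (P : E -> probability Omega R) (X : nat -> Omega -> E)
    (Y : nat -> {mfun Omega >-> R})
    (f h : E -> R) (g : R -> R) (p : E -> R)
    (markovX : markov_chain P X) (absX : absorbing_chain P X)
    (unifY : iid_uniform P Y) (indepXY : independent_processes P X Y)
    (g0 : g = fun=> 0) (strat_p : stopping_strategy p) :
  equilibrium P X Y f h g p <->
  optimal_stopping_time P X Y f h g (strategy_time X Y p).
Proof.
have rewardE sigma x : reward P X f h g sigma x = stopped_mean P X f sigma x.
  by rewrite /reward g0 addr0.
have st := @strategy_time_stopping _ _ _ _ X Y p.
set tau := strategy_time X Y p in st *; set phi := stopped_mean P X f tau.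
split => [eq_p|[_ opt]].
  have fphi y : f y <= phi y.
    have := eq_p 1 y; rewrite rewardE g0 ler01 lexx => /(_ isT).
    by rewrite subrr mul0r !addr0 mul1r.
  have Tphi y : one_step_mean P X phi y <= phi y.
    have := eq_p 0 y; rewrite rewardE g0 ler01 lexx => /(_ isT).
    by rewrite subr0 mul0r add0r addr0 mul1r.
  split => // x; apply/eqP; rewrite eq_le; apply/andP; split.
    by apply: ereal_sup_ubound; exists tau.
  apply: ge_ereal_sup => _ [sigma st_sigma <-]; rewrite lee_fin !rewardE.
  exact: (le_stopped_mean markovX indepXY absX x st_sigma fphi Tphi).
have {}opt sigma x : stopping_time X Y sigma ->
    stopped_mean P X f sigma x <= phi x.
  move=> st_sigma; rewrite -lee_fin -(rewardE sigma) /phi -(rewardE tau) opt.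
  by apply: ereal_sup_ubound; exists sigma.
move=> q x /andP[q0 q1]; rewrite rewardE g0 addr0 -/tau -/phi.
have [fphi Tphi] := value_superharmonic markovX indepXY absX st opt x.
(* Splitting [phi x] with the weights [q] and [1 - q] lets stopping and continuing be compared term
   by term. *)
rewrite [leRHS](_ : _ = q * phi x + (1 - q) * phi x); last first.
  by rewrite -mulrDl subrKC mul1r.
by apply: lerD; apply: ler_wpM2l; rewrite ?subr_ge0.
Qed.
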